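(* Let $a\in\,]0,1[$, $b=\sqrt{1-a^2}$, and let $M$ be an $m$-dimensional submanifold of the hypersphere $\mathbb{S}^{n-1}(a)\subset\mathbb{S}^n$. Then $M$ is harmonic in $\mathbb{S}^{n-1}(a)$ if and only if $M$ is properly biharmonic of index $m\bigl(1-\frac{b^2}{a^2}\bigr)$ in $\mathbb{S}^n$.
   Context: $\mathbb{S}^n\subset\mathbb{R}^{n+1}$ is the unit sphere with its canonical metric; all submanifolds carry the induced metric. For $a\in\,]0,1]$, $b=\sqrt{1-a^2}$, the hypersphere of radius $a$ is $\mathbb{S}^{n-1}(a)=\{(x,b)\in\mathbb{R}^{n+1}: x\in\mathbb{R}^n,\ |x|=a\}\subset\mathbb{S}^n$. The mean curvature of an $m$-dimensional submanifold is $\frac1m\operatorname{tr}B$, with $B$ its second fundamental form in the given ambient manifold; a submanifold is harmonic in an ambient manifold (its inclusion is a harmonic map) iff its mean curvature there vanishes. Let $H$ be the mean curvature of $M$ in $\mathbb{S}^n$, $i:M\to\mathbb{S}^n$ the inclusion, and $\Delta=-\operatorname{tr}\nabla^2$ the (nonnegative) rough Laplacian on sections of $i^*T\mathbb{S}^n$. $M$ is biharmonic of index $k\in\mathbb{R}$ in $\mathbb{S}^n$ if $(\Delta-m+k)H=0$, and properly so if moreover $M$ is not harmonic in $\mathbb{S}^n$ ($H\not\equiv0$). *)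

(* Defs.v *)
From HB Require Import structures.
From mathcomp Require Import all_boot all_order all_algebra.
From mathcomp Require Import all_classical all_reals all_analysis.

Set Implicit Arguments.
Unset Strict Implicit.
Unset Printing Implicit Defensive.

Import Order.TTheory GRing.Theory Num.Theory.
Import numFieldNormedType.Exports.

Local Open Scope classical_set_scope.
Local Open Scope ring_scope.

(* The library norm `|x| on 'rV[R]_d is the sup norm: it is used here only for
   the topology and the derivatives.  Metric notions go through [dot]. *)
Definition dot (R : realType) (d : nat) (x y : 'rV[R]_d) : R := (x *m y^T) 0 0.

Definition enorm (R : realType) (d : nat) (x : 'rV[R]_d) : R :=
  Num.sqrt (dot x x).

(* The orthogonal projection of [v] on a linear subspace [T]. *)
Definition oproj (R : realType) (d : nat) (T : set 'rV[R]_d) (v : 'rV[R]_d) :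
    'rV[R]_d :=
  get [set w | T w /\ forall z, T z -> dot (v - w) z = 0].

Definition partial (R : realType) (m d : nat) (i : 'I_m)
    (f : 'rV[R]_m -> 'rV[R]_d) : 'rV[R]_m -> 'rV[R]_d :=
  fun u => 'D_(delta_mx 0 i) f u.

(* [f] is C^oo on the open set [U] iff all its iterated partial derivatives are
   differentiable at the points of [U]. *)
Definition smooth_on (R : realType) (m d : nat) (U : set 'rV[R]_m)
    (f : 'rV[R]_m -> 'rV[R]_d) : Prop :=
  forall (s : seq 'I_m) (u : 'rV[R]_m), U u ->
    differentiable (foldr (fun i g => partial i g) f s) u.

Record patch (R : realType) (m d : nat) := Patch {
  dom : set 'rV[R]_m;
  pmap :> 'rV[R]_m -> 'rV[R]_d
}.

(* Submanifolds of R^d of dimension m: a subset with a (not necessarily maximal)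
   smooth atlas of local parametrizations that are injective immersions in R^d.
   The manifold topology is the one of the atlas, so that both embedded and
   injectively immersed submanifolds are covered; for an embedded submanifold
   one takes, e.g., all local parametrizations. *)
Record submanifold (R : realType) (m d : nat) := Submanifold {
  carrier :> set 'rV[R]_d;
  patches : set (patch R m d);
  patch_open : forall P, patches P -> open (dom P);
  patch_smooth : forall P, patches P -> smooth_on (dom P) P;
  patch_immersion : forall P, patches P ->
    forall u, dom P u -> injective ('d P u);
  patch_inj : forall P, patches P -> {in dom P &, injective P};
  patch_sub : forall P, patches P -> P @` dom P `<=` carrier;
  patch_cover : forall p, carrier p ->
    exists2 P, patches P & (P @` dom P) p;
  patch_compat : forall P Q, patches P -> patches Q ->
    let W := dom P `&` P @^-1` (Q @` dom Q) in
    open W /\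
    exists2 t : 'rV[R]_m -> 'rV[R]_m, smooth_on W t &
      forall u, W u -> dom Q (t u) /\ Q (t u) = P u
}.

Section InducedMetric.
Variables (R : realType) (m d : nat) (P : patch R m d).

Definition metric (u : 'rV[R]_m) : 'M[R]_m :=
  \matrix_(i, j) dot (partial i P u) (partial j P u).

Definition metric_inv (u : 'rV[R]_m) : 'M[R]_m := invmx (metric u).

Definition dmetric (l i j : 'I_m) (u : 'rV[R]_m) : R :=
  'D_(delta_mx 0 l) (fun v => metric v i j) u.

(* Christoffel symbols Gamma^k_ij of the Levi-Civita connection of the induced
   metric. *)
Definition christoffel (k i j : 'I_m) (u : 'rV[R]_m) : R :=
  2^-1 * \sum_l metric_inv u k l *
    (dmetric i j l u + dmetric j i l u - dmetric l i j u).

End InducedMetric.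

(* Velocities at p of the curves of N. *)
Definition tangent (R : realType) (d : nat) (N : set 'rV[R]_d) (p : 'rV[R]_d) :
    set 'rV[R]_d :=
  [set v | exists c : R -> 'rV[R]_d,
    [/\ c 0 = p, \forall t \near (0 : R), N (c t) & is_derive (0 : R) (1 : R) c v]].

Section AmbientConnection.
Variables (R : realType) (m d : nat).
Variables (N : set 'rV[R]_d) (P : patch R m d).

(* Covariant derivative in the i-th coordinate direction of a section V, along
   the patch P, of the tangent bundle of N: the Levi-Civita connection of the
   metric induced on N by R^d is the tangential part of the flat derivative. *)
Definition covder (i : 'I_m) (V : 'rV[R]_m -> 'rV[R]_d) :
    'rV[R]_m -> 'rV[R]_d :=
  fun u => oproj (tangent N (P u)) (partial i V u).

(* B(d_i, d_j): the component normal to the patch of the covariant derivative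
   in N of the coordinate field d_j in the direction d_i. *)
Definition second_fundamental_form (i j : 'I_m) (u : 'rV[R]_m) : 'rV[R]_d :=
  let w := covder i (partial j P) u in w - oproj (range ('d P u)) w.

Definition mean_curvature (u : 'rV[R]_m) : 'rV[R]_d :=
  m%:R^-1 *:
    \sum_i \sum_j metric_inv P u i j *: second_fundamental_form i j u.

Definition second_covder (i j : 'I_m) (V : 'rV[R]_m -> 'rV[R]_d) :
    'rV[R]_m -> 'rV[R]_d :=
  fun u => covder i (covder j V) u -
           \sum_k christoffel P k i j u *: covder k V u.

Definition rough_laplacian (V : 'rV[R]_m -> 'rV[R]_d) : 'rV[R]_m -> 'rV[R]_d :=
  fun u => - \sum_i \sum_j metric_inv P u i j *: second_covder i j V u.

End AmbientConnection.

(* R^(n+1) is 'rV[R]_(n + 1), so that (x, b) is [row_mx x b%:M]. *)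
Definition sphere (R : realType) (n : nat) : set 'rV[R]_(n + 1) :=
  [set p | enorm p = 1].
Arguments sphere R n : clear implicits.

Definition hypersphere (R : realType) (n : nat) (a : R) : set 'rV[R]_(n + 1) :=
  [set row_mx x (Num.sqrt (1 - a ^+ 2))%:M |
     x in [set x : 'rV[R]_n | enorm x = a]].
Arguments hypersphere {R} n a.

Definition harmonic_in (R : realType) (m d : nat) (N : set 'rV[R]_d)
    (M : submanifold R m d) : Prop :=
  forall P, patches M P -> forall u, dom P u -> mean_curvature N P u = 0.

Definition biharmonic_in_sphere (R : realType) (m n : nat) (k : R)
    (M : submanifold R m (n + 1)) : Prop :=
  forall P, patches M P -> forall u, dom P u ->
    let H := mean_curvature (sphere R n) P in
    rough_laplacian (sphere R n) P H u - m%:R *: H u + k *: H u = 0.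

Definition properly_biharmonic_in_sphere (R : realType) (m n : nat) (k : R)
    (M : submanifold R m (n + 1)) : Prop :=
  biharmonic_in_sphere k M /\ ~ harmonic_in (sphere R n) M.

(* Main.v *)
Require Import Defs.
From mathcomp Require Import all_boot all_order all_algebra.
From mathcomp Require Import all_classical all_reals all_analysis.
From mathcomp Require Import ring lra.

Set Implicit Arguments.
Unset Strict Implicit.
Unset Printing Implicit Defensive.

Import Order.TTheory GRing.Theory Num.Theory.
Import numFieldNormedType.Exports.

Local Open Scope classical_set_scope.
Local Open Scope ring_scope.

(** Let P be a local parametrization of M, X_i its coordinate fields, g the
    induced metric, e the pole (0, 1), and eta = (b / a) p - (1 / a) e the unit
    normal of the hypersphere in the sphere at p.  Along P, eta is an affine
    function of P, so d_i eta = (b / a) X_i; hence the second fundamental form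
    of the hypersphere is -(b / a) g in the direction eta, and the mean
    curvatures of M in the two ambient manifolds differ by (b / a) eta
    ([mean_hypersphere]).  So M is harmonic in the hypersphere iff its mean
    curvature H in the sphere is -(b / a) eta.  In all cases the component of H
    along eta is -b / a, which is not 0 ([dot_mean_normal]): M is never harmonic
    in the sphere, and only the biharmonic equation matters.  With
    k = m (1 - b^2 / a^2), this equation says Delta H = m (b^2 / a^2) H.

    If H = -(b / a) eta, then nabla_j H = -(b^2 / a^2) X_j.  By the Koszul
    formula the Christoffel symbols give the tangential part of d_i d_j P, so
    the second covariant derivative of H is -(b^2 / a^2) B, where B is the second
    fundamental form of M in the sphere, and its trace gives the equation
    ([minimal_biharmonic]).

    Conversely, the component along eta of the equation determines H at each
    point.  Differentiating the constants <H, eta> and <H, X_i> gives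
    <nabla_j H, eta> = 0 and <nabla_j H, X_i> = - <H, d_j d_i P>; differentiating
    the former again gives
    <Delta H, eta> = -(b / a) m |H|^2 ([dot_laplacian_normal]).  The equation then
    forces |H|^2 = b^2 / a^2, whence |H + (b / a) eta|^2 = 0
    ([biharmonic_minimal]).

    Two analytic facts support this: the symmetry of second partial derivatives
    ([deriveC]), for the Koszul formula, and the stability of C^k functions under
    the operations that produce H, matrix inversion included ([mean_vck]),
    without which the derivatives of H could not be computed. *)

(** * Scalar products and their derivatives *)

Section DotProduct.
Context {R : realType} {d : nat}.
Implicit Types x y z : 'rV[R]_d.

Lemma dotE x y : dot x y = \sum_c x 0 c * y 0 c.
Proof. by rewrite /dot mxE; apply: eq_bigr => c _; rewrite mxE. Qed.

Lemma dotC x y : dot x y = dot y x.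
Proof. by rewrite !dotE; apply: eq_bigr => c _; rewrite mulrC. Qed.

Lemma dotDl x y z : dot (x + y) z = dot x z + dot y z.
Proof. by rewrite /dot mulmxDl mxE. Qed.

Lemma dotNl x z : dot (- x) z = - dot x z.
Proof. by rewrite /dot mulNmx mxE. Qed.

Lemma dotBl x y z : dot (x - y) z = dot x z - dot y z.
Proof. by rewrite dotDl dotNl. Qed.

Lemma dotZl a x z : dot (a *: x) z = a * dot x z.
Proof. by rewrite /dot -scalemxAl mxE. Qed.

Lemma dotDr x y z : dot z (x + y) = dot z x + dot z y.
Proof. by rewrite !(dotC z) dotDl. Qed.

Lemma dotNr x z : dot z (- x) = - dot z x.
Proof. by rewrite !(dotC z) dotNl. Qed.

Lemma dotBr x y z : dot z (x - y) = dot z x - dot z y.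
Proof. by rewrite !(dotC z) dotBl. Qed.

Lemma dotZr a x z : dot z (a *: x) = a * dot z x.
Proof. by rewrite !(dotC z) dotZl. Qed.

Lemma dot0l z : dot 0 z = 0.
Proof. by rewrite /dot mul0mx mxE. Qed.

Lemma dot_suml I (r : seq I) (F : I -> 'rV[R]_d) z :
  dot (\sum_(i <- r) F i) z = \sum_(i <- r) dot (F i) z.
Proof. exact: (big_morph _ (fun x y => dotDl x y z) (dot0l z)). Qed.

Definition dotL := (dotDl, dotNl, dotZl, dotDr, dotNr, dotZr).

Lemma dot_eq0 x : dot x x = 0 -> x = 0.
Proof.
rewrite dotE => /eqP; rewrite psumr_eq0; last by move=> c _; rewrite -expr2 sqr_ge0.
move=> /allP h; apply/rowP => c; rewrite mxE; apply/eqP.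
by have := h c (mem_index_enum _); rewrite mulf_eq0 orbb.
Qed.

Lemma dot_ge0 x : 0 <= dot x x.
Proof. by rewrite dotE sumr_ge0 // => c _; rewrite -expr2 sqr_ge0. Qed.

(** [oproj] picks a point by choice; it is determined as soon as [T] is stable
    under subtraction, since two candidates differ by a vector of [T] that is
    orthogonal to itself. *)
Lemma oprojE (T : set 'rV[R]_d) v w :
  (forall x y, T x -> T y -> T (x - y)) ->
  T w -> (forall z, T z -> dot (v - w) z = 0) -> oproj T v = w.
Proof.
move=> TB Tw vw; rewrite /oproj.
have [Tg vg] : [set w | T w /\ forall z, T z -> dot (v - w) z = 0]
    (oproj T v) by apply: getPex; exists w.
apply/eqP; rewrite -subr_eq0; apply/eqP/dot_eq0.
set g := get _; have gw : T (g - w) by exact: TB.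
have -> : dot (g - w) (g - w) = dot (v - w) (g - w) - dot (v - g) (g - w).
  by rewrite -dotBl opprB [v - w + _]addrC subrKA.
by rewrite vw // vg // subr0.
Qed.

End DotProduct.

Section Derivatives.
Context {R : realType} {V : normedModType R}.

Lemma is_derive_coord {d} (f : V -> 'rV[R]_d) u v (df : 'rV[R]_d) (c : 'I_d) :
  is_derive u v f df -> is_derive u v (fun x => f x 0 c) (df 0 c).
Proof.
move=> [fd <-]; split; first by have /derivable_mxP := fd; exact.
by rewrite derive_mx // mxE.
Qed.

Lemma is_derive_rV {d} (f : V -> 'rV[R]_d) u v (df : 'rV[R]_d) :
  (forall c, is_derive u v (fun x => f x 0 c) (df 0 c)) -> is_derive u v f df.
Proof.
move=> h; have fd : derivable f u v.
  by apply/derivable_mxP => i c; rewrite ord1; have [] := h c.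
split => //; apply/rowP => c.
by rewrite derive_mx // mxE; have [_ ->] := h c.
Qed.

Lemma is_derive_dot {d} (f g : V -> 'rV[R]_d) u v (df dg : 'rV[R]_d) :
  is_derive u v f df -> is_derive u v g dg ->
  is_derive u v (fun x => dot (f x) (g x)) (dot df (g u) + dot (f u) dg).
Proof.
move=> fd gd.
have -> : (fun x => dot (f x) (g x)) =
    \sum_c (fun x => f x 0 c) * (fun x => g x 0 c).
  by apply/funext => x; rewrite dotE fct_sumE.
apply: is_derive_eq.
  apply: is_derive_sum => c; apply: is_deriveM; exact: is_derive_coord.
rewrite addrC !dotE -big_split /=; apply: eq_bigr => c _.
by rewrite [df 0 c * _]mulrC.
Qed.

Lemma derive_dot_const {d} (f g : V -> 'rV[R]_d) u v (df dg : 'rV[R]_d) r :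
  is_derive u v f df -> is_derive u v g dg ->
  (\forall x \near u, dot (f x) (g x) = r) ->
  dot df (g u) + dot (f u) dg = 0.
Proof.
move=> fd gd h; have [_ <-] := is_derive_dot fd gd.
by rewrite (near_eq_derive v (g := cst r)) ?derive_cst.
Qed.

Lemma derive_dot_constl {d} (f g : V -> 'rV[R]_d) u v (df dg : 'rV[R]_d) r :
  is_derive u v f df -> is_derive u v g dg ->
  (\forall x \near u, dot (f x) (g x) = r) ->
  dot df (g u) = - dot (f u) dg.
Proof.
by move=> fd gd h; apply/eqP; rewrite -addr_eq0 (derive_dot_const fd gd h).
Qed.

Lemma is_derive_scale {d} (f : V -> R) (w : 'rV[R]_d) u v (df : R) :
  is_derive u v f df -> is_derive u v (fun x => f x *: w) (df *: w).
Proof.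
move=> fd; apply: is_derive_rV => c.
have -> : (fun x => (f x *: w) 0 c) = w 0 c \*: f.
  by apply/funext => x; rewrite mxE mulrC.
by apply: is_derive_eq; rewrite mxE mulrC.
Qed.

End Derivatives.

(** * Symmetry of second derivatives *)

Section Schwarz.
Context {R : realType} {V : normedModType R}.
Implicit Types (f : V -> R) (u v w : V).

Lemma is_derive_line f u v s (df : R) : is_derive (u + s *: v) v f df ->
  is_derive s 1 (fun s => f (u + s *: v)) df.
Proof.
move=> [fd <-].
have E : (fun h : R => h^-1 *: (((fun s => f (u + s *: v)) \o shift s) (h *: 1)
      - f (u + s *: v))) =
    (fun h => h^-1 *: ((f \o shift (u + s *: v)) (h *: v) - f (u + s *: v))).
  apply/funext => h /=; congr (_ *: (f _ - _)).
  by rewrite [h *: 1]mulr1 scalerDl addrCA.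
by split; rewrite ?/derivable ?/derive E.
Qed.

(** The mean value theorem in the direction [v] turns the second difference into
    h times an increment of [g] in the direction [w], which the first-order
    expansion of [g] at [u] evaluates: its differentiability at the single point
    [u] suffices. *)
Lemma second_difference_cvg f g u v w :
  (\forall x \near u, is_derive x v f (g x)) -> differentiable g u ->
  (fun h => (f (u + h *: v + h *: w) - f (u + h *: v)
             - f (u + h *: w) + f u) / h ^+ 2) @ 0^'+ --> 'D_w g u.
Proof.
move=> fv gd; rewrite deriveE //.
apply/cvgrPdist_le => e e0; set L := 'd g u.
(* The points u + c v + h w and u + c v with 0 <= c <= h lie within h C of u. *)
pose C := `|v| + `|v| + `|w| + 1.
have C0 : 0 < C by rewrite /C ltr_wpDl // !addr_ge0.
have [r /= r0 hr] : exists2 r, 0 < r & forall k, `|k| < r ->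
    is_derive (u + k) v f (g (u + k)) /\ `|g (u + k) - g u - L k| <= e / C * `|k|.
  have eC : 0 < e / C by exact: divr_gt0.
  have gl := diff_locally gd.
  set o := 'o _ in gl.
  have /(littleoP [littleo of o]) /nbhs_ballP [r1 /= r10 h1] := eC.
  have /nbhs_ballP [r2 /= r20 h2] := fv.
  exists (Num.min r1 r2); first by rewrite lt_min r10.
  move=> k; rewrite lt_min => /andP[k1 k2]; split.
    apply: h2; rewrite -ball_normE /= opprD addNKr normrN //.
  have -> : g (u + k) - g u - L k = o k.
    have gE : g (k + u) = g u + L k + o k := congr1 (fun F => F k) gl.
    by rewrite [u + k]addrC gE; ring.
  by apply: h1; rewrite -ball_normE /= sub0r normrN.
near=> h.
have h0 : 0 < h by near: h; exact: nbhs_right_gt.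
have hC : h * C < r.
  by rewrite -ltr_pdivlMr //; near: h; apply: nbhs_right_lt; rewrite divr_gt0.
have small s : 0 <= s <= h -> `|s *: v + h *: w| + `|s *: v| <= h * C /\
    `|s *: v| < r.
  move=> /andP[s0 sh]; have sv : `|s *: v| <= h * `|v|.
    by rewrite normrZ ger0_norm // ler_wpM2r.
  have hw : `|h *: w| = h * `|w| by rewrite normrZ gtr0_norm.
  have := ler_normD (s *: v) (h *: w); rewrite hw.
  have : 0 <= h * `|v| by rewrite mulr_ge0 // ltW.
  have : 0 <= h * `|w| by rewrite mulr_ge0 // ltW.
  move: hC; rewrite /C !mulrDr mulr1; lra.
pose phi s := f (u + h *: w + s *: v) - f (u + s *: v).
have dphi s : 0 <= s <= h ->
    is_derive s 1 phi (g (u + h *: w + s *: v) - g (u + s *: v)).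
  move=> sh; have [h1 h2] := small _ sh.
  apply: is_deriveB; apply: is_derive_line.
    have := hr (s *: v + h *: w); rewrite [s *: v + _]addrC addrA => H.
    apply: (H _).1; rewrite [h *: w + _]addrC.
    by apply: le_lt_trans hC; apply: le_trans h1; rewrite lerDl.
  by have [] := hr _ h2.
pose dp s := g (u + h *: w + s *: v) - g (u + s *: v).
have [||c] := @MVT R phi dp 0 h h0.
- by move=> x; rewrite in_itv /= => /andP[x0 xh]; apply: dphi; rewrite !ltW.
- apply: derivable_within_continuous => x; rewrite in_itv /= => /dphi [].
  by [].
rewrite in_itv /= => /andP[c0 ch]; rewrite subr0 /dp => E.
have ce : 0 <= c <= h by rewrite !ltW.
have [h1 h2] := small _ ce.
have -> : f (u + h *: v + h *: w) - f (u + h *: v) - f (u + h *: w) + f u =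
    phi h - phi 0.
  rewrite /phi !scale0r !addr0 [u + h *: v + _]addrAC; ring.
rewrite E expr2 invfM mulrA mulfK ?gt_eqF //.
have [_ b2] := hr _ h2.
have c1 : `|c *: v + h *: w| < r.
  by apply: le_lt_trans hC; apply: le_trans h1; rewrite lerDl.
have [_] := hr _ c1.
rewrite [c *: v + _]addrC addrA linearD !linearZ /=.
rewrite linearZ /= in b2.
move=> b1.
rewrite -(ler_pM2l h0) -[X in X * `|_|]gtr0_norm // -normrM.
set g1 := g (u + h *: w + _) in b1 *; set g2 := g (u + c *: v) in b2 *.
have -> : h * (L w + (g1 - g2) *: - h^-1) =
  (g2 - g u - c * L v) - (g1 - g u - (h * L w + c * L v)).
  rewrite -[_ *: _]/(_ * _); have : h != 0 by rewrite gt_eqF.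
  by move: (L w : R) (L v : R) (g u : R) (g1 : R) (g2 : R) => p q x y z hn; field.
apply: le_trans (ler_normB _ _) _; apply: le_trans (lerD b2 b1) _.
rewrite -mulrDr [h *: w + _]addrC [`|c *: v| + _]addrC.
rewrite mulrAC ler_pdivrMr // -mulrA [h * _]mulrC -mulrA [e * _]mulrC [e * _]mulrC.
by rewrite ler_pM2r // mulrC.
Unshelve. all: by end_near. Qed.

(** The second difference is symmetric in [v] and [w], so both mixed derivatives
    are its limit. *)
Lemma deriveC f fv fw u v w :
  (\forall x \near u, is_derive x v f (fv x)) ->
  (\forall x \near u, is_derive x w f (fw x)) ->
  differentiable fv u -> differentiable fw u ->
  'D_w fv u = 'D_v fw u.
Proof.
move=> dv dw fvd fwd.
have h1 := second_difference_cvg dv fvd.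
have h2 := second_difference_cvg dw fwd.
apply: (cvg_unique _ (h1 w)) => //.
apply: cvg_trans (h2 v); apply: near_eq_cvg; near=> h.
by congr (_ / _); rewrite [u + _ + _]addrAC; ring.
Unshelve. all: by end_near. Qed.

End Schwarz.

(** * Functions of class C^k *)

Section Ck.
Context {R : realType} {m : nat}.
Variable U : set 'rV[R]_m.
Hypothesis Uo : open U.
Implicit Types f g : 'rV[R]_m -> R.

(** Functions of class C^k, in the weak sense that iterated partial derivatives
    up to order [k] exist on [U]: this is all that product rules need, and it is
    stable under the operations below. *)
Fixpoint ck (k : nat) (f : 'rV[R]_m -> R) : Prop :=
  if k is k'.+1 then forall i : 'I_m,
    (forall u, U u -> derivable f u (delta_mx 0 i)) /\
    ck k' ('D_(delta_mx 0 i) f)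
  else True.

Lemma near_open u : U u -> \forall x \near u, U x.
Proof. by move=> Uu; apply: open_nbhs_nbhs. Qed.

Lemma ck_eq k f g : (forall u, U u -> f u = g u) -> ck k f -> ck k g.
Proof.
elim: k f g => // k IH f g fg fk i; have [fd fi] := fk i; split=> [u Uu|].
  apply: near_eq_derivable (fd u Uu).
  by apply: filterS (near_open Uu) => x /fg.
apply: IH fi => u Uu; apply: near_eq_derive.
by apply: filterS (near_open Uu) => x /fg.
Qed.

Lemma ckW k f : ck k.+1 f -> ck k f.
Proof. by elim: k f => // k IH f fk i; have [fd fi] := fk i; split=> //; exact: IH. Qed.

Lemma ck_cst k r : ck k (cst r).
Proof.
elim: k r => // k IH r i; split=> [u _|]; first exact: derivable_cst.
by apply: ck_eq (IH 0) => u _; rewrite derive_cst.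
Qed.

Lemma ckD k f g : ck k f -> ck k g -> ck k (fun u => f u + g u).
Proof.
elim: k f g => // k IH f g fk gk i; have [fd fi] := fk i; have [gd gi] := gk i.
split=> [u Uu|]; first by apply: derivableD; [exact: fd|exact: gd].
by apply: ck_eq (IH _ _ fi gi) => u Uu; rewrite deriveD; [|exact: fd|exact: gd].
Qed.

Lemma ckM k f g : ck k f -> ck k g -> ck k (fun u => f u * g u).
Proof.
elim: k f g => // k IH f g fk gk i; have [fd fi] := fk i; have [gd gi] := gk i.
split=> [u Uu|]; first by apply: derivableM; [exact: fd|exact: gd].
apply: ck_eq (ckD (IH _ _ (ckW fk) gi) (IH _ _ (ckW gk) fi)) => u Uu.
by rewrite deriveM; [|exact: fd|exact: gd].
Qed.

Lemma ckN k f : ck k f -> ck k (fun u => - f u).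
Proof.
by move=> fk; apply: ck_eq (ckM (ck_cst k (- 1)) fk) => u _; rewrite mulN1r.
Qed.

Lemma ckV k f : (forall u, U u -> f u != 0) -> ck k f -> ck k (fun u => (f u)^-1).
Proof.
move=> f0; elim: k => // k IH fk i; have [fd fi] := fk i.
split=> [u Uu|]; first by apply: derivableV; [exact: f0|exact: fd].
have fV := IH (ckW fk).
apply: ck_eq (ckN (ckM (ckM fV fV) fi)) => u Uu.
rewrite deriveV; [|exact: f0|exact: fd].
by rewrite expr2 invfM -mulNr.
Qed.

Lemma ck_sum k I (r : seq I) (F : I -> 'rV[R]_m -> R) :
  (forall i, ck k (F i)) -> ck k (fun u => \sum_(i <- r) F i u).
Proof.
move=> Fk; elim: r => [|i r IH].
  by apply: ck_eq (ck_cst k 0) => u _; rewrite big_nil.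
by apply: ck_eq (ckD (Fk i) IH) => u _; rewrite big_cons.
Qed.

Lemma ck_prod k I (r : seq I) (F : I -> 'rV[R]_m -> R) :
  (forall i, ck k (F i)) -> ck k (fun u => \prod_(i <- r) F i u).
Proof.
move=> Fk; elim: r => [|i r IH].
  by apply: ck_eq (ck_cst k 1) => u _; rewrite big_nil.
by apply: ck_eq (ckM (Fk i) IH) => u _; rewrite big_cons.
Qed.

Lemma ck_det k n (A : 'rV[R]_m -> 'M[R]_n) :
  (forall i j, ck k (fun u => A u i j)) -> ck k (fun u => \det (A u)).
Proof.
move=> Ak; apply: ck_sum => s; apply: ckM; first exact: (ck_cst k (_ ^+ _)).
by apply: ck_prod => i.
Qed.

Lemma ck_invmx k n (A : 'rV[R]_m -> 'M[R]_n) i j :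
  (forall u, U u -> A u \in unitmx) ->
  (forall i j, ck k (fun u => A u i j)) -> ck k (fun u => invmx (A u) i j).
Proof.
move=> Au Ak.
have dk : ck k (fun u => (\det (A u))^-1).
  by apply: ckV (ck_det Ak) => u /Au; rewrite unitmxE unitfE.
have ak : ck k (fun u => cofactor (A u) j i).
  apply: ckM; first exact: (ck_cst k (_ ^+ _)).
  apply: ck_det => a c; apply: ck_eq (Ak (lift j a) (lift i c)) => u _.
  by rewrite !mxE.
apply: ck_eq (ckM dk ak) => u /Au Auu.
by rewrite /invmx Auu !mxE.
Qed.

Definition vck d k (f : 'rV[R]_m -> 'rV[R]_d) :=
  forall c, ck k (fun u => f u 0 c).

Lemma vck_dot d k (f g : 'rV[R]_m -> 'rV[R]_d) :
  vck k f -> vck k g -> ck k (fun u => dot (f u) (g u)).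
Proof.
move=> fk gk; apply: ck_eq (fun u => \sum_c f u 0 c * g u 0 c) _ _ _.
  by move=> u _; rewrite dotE.
by apply: ck_sum => c; apply: ckM.
Qed.

Lemma vck_derive d k (f : 'rV[R]_m -> 'rV[R]_d) u i : vck k.+1 f -> U u ->
  is_derive u (delta_mx 0 i) f (partial i f u).
Proof.
move=> fk Uu; apply: derivableP; apply/derivable_mxP => j c; rewrite ord1.
by have [h _] := fk c i; exact: h.
Qed.

Lemma vck_partial d k (f : 'rV[R]_m -> 'rV[R]_d) i :
  vck k.+1 f -> vck k (partial i f).
Proof.
move=> fk c; have [_] := fk c i; apply: ck_eq => u Uu.
have [_ <-] := is_derive_coord c (vck_derive i fk Uu).
by [].
Qed.

Lemma smooth_vck d k (f : 'rV[R]_m -> 'rV[R]_d) : smooth_on U f -> vck k f.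
Proof.
move=> fs; have : forall s, vck k (foldr (@partial R m d) f s).
  elim: k => // k IH s c i; split=> [u Uu|].
    have /derivable_mxP h := diff_derivable (v := delta_mx 0 i) (fs s u Uu).
    exact: h.
  apply: ck_eq (IH (i :: s) c) => u Uu /=.
  have /derivableP h := diff_derivable (v := delta_mx 0 i) (fs s u Uu).
  by have [_ ->] := is_derive_coord c h.
by move/(_ [::]).
Qed.

(** [deriveC] applies to each component of [f]. *)
Lemma smooth_partialC d (f : 'rV[R]_m -> 'rV[R]_d) i j u : smooth_on U f ->
  U u -> partial i (partial j f) u = partial j (partial i f) u.
Proof.
move=> fs Uu.
have f1 k x : U x -> is_derive x (delta_mx 0 k) f (partial k f x).
  by apply: vck_derive; apply: (smooth_vck 1).
have f2 k l : is_derive u (delta_mx 0 l) (partial k f) (partial l (partial k f) u).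
  by apply: vck_derive Uu; apply/vck_partial/(smooth_vck 2).
apply/rowP => c.
have E k l : partial l (partial k f) u 0 c =
    'D_(delta_mx 0 l) (fun x => partial k f x 0 c) u.
  by have [_ ->] := is_derive_coord c (f2 k l).
apply: etrans (E j i) (etrans _ (esym (E i j))).
have fc k : \forall x \near u,
    is_derive x (delta_mx 0 k) (fun y => f y 0 c) (partial k f x 0 c).
  by apply: filterS (near_open Uu) => x Ux; apply/is_derive_coord/f1.
have dc k : differentiable (fun x => partial k f x 0 c) u.
  apply: (differentiable_comp (f := partial k f) (g := fun M => M 0 c)).
    exact: (fs [:: k]).
  exact: differentiable_coord.
exact: deriveC (fc j) (fc i) (dc j) (dc i).
Qed.

End Ck.

(** * Tangent spaces of the sphere and the hypersphere *)

Section CircleCurve.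
Context {R : realType} {d : nat}.

(** The rational parametrization of the circle through [p] with velocity [v]
    avoids square roots and trigonometric functions: with q = |v|^2 / (4 |p|^2),
    c(t) = (t v + (1 - q t^2) p) / (1 + q t^2).  The last clause says that [c]
    stays in the plane spanned by [p] and [v]. *)
Lemma circle_curve (p v : 'rV[R]_d) : dot p p != 0 -> dot v p = 0 ->
  exists c : R -> 'rV[R]_d,
  [/\ c 0 = p, is_derive (0 : R) (1 : R) c v,
      forall t, dot (c t) (c t) = dot p p &
      forall w t, dot p w = 0 -> dot v w = 0 -> dot (c t) w = 0].
Proof.
move=> p0 vp; pose q : R := dot v v / dot p p / 4.
have q0 : 0 <= q by rewrite !divr_ge0 // dot_ge0.
have D0 t : 1 + q * t ^+ 2 != 0.
  by rewrite gt_eqF // ltr_pwDl // mulr_ge0 // sqr_ge0.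
pose sq : R -> R := id * id.
have dsq (r : R) : is_derive (0 : R) (1 : R) (r \*: sq) 0.
  have d0 : is_derive (0 : R) (1 : R) sq (0 *: 1 + 0 *: 1) by exact: is_deriveM.
  have := is_deriveZ r d0.
  by move/is_derive_eq; apply; rewrite scale0r addr0 scaler0.
pose D : R -> R := cst 1 + q \*: sq.
pose Dv t := (D t)^-1.
have DE t : D t = 1 + q * t ^+ 2 by rewrite expr2.
(* The coefficient of p is written 1 - 2 q t^2 / (1 + q t^2). *)
exists (fun t => (t * Dv t) *: v + (1 - 2 * q * (t * t) * Dv t) *: p); split.
- by rewrite !mul0r mulr0 mul0r subr0 scale0r scale1r add0r.
- have dD : is_derive (0 : R) (1 : R) D 0.
    have := is_deriveD (is_derive_cst (1 : R) (0 : R) (1 : R)) (dsq q).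
    by rewrite addr0.
  have dDv : is_derive (0 : R) (1 : R) Dv 0.
    have D00 : D 0 != 0 by rewrite DE.
    have [Dd De] := dD.
    split; first exact: derivableV.
    by rewrite deriveV // De scaler0.
  have d1 : is_derive (0 : R) (1 : R) (fun t => t * Dv t) 1.
    have := is_deriveM (is_derive_id (0 : R) 1) dDv.
    move/is_derive_eq; apply.
    by rewrite scale0r add0r /Dv DE expr0n mulr0 addr0 invr1 scale1r.
  have d2 : is_derive (0 : R) (1 : R) (fun t => 1 - 2 * q * (t * t) * Dv t) 0.
    have h2 := is_deriveB (is_derive_cst (1 : R) (0 : R) (1 : R))
      (is_deriveM (dsq (2 * q)) dDv).
    by move/is_derive_eq : h2; apply; rewrite !scaler0 addr0 subr0.
  have := is_deriveD (is_derive_scale v d1) (is_derive_scale p d2).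
  by move/is_derive_eq; apply; rewrite scale1r scale0r addr0.
- move=> t; rewrite !dotL [dot p v]dotC vp.
  have -> : dot v v = 4 * q * dot p p by rewrite /q; field.
  have := D0 t; rewrite /Dv DE => Dt; field.
  by [].
- by move=> w t pw vw; rewrite !dotL pw vw !mulr0 addr0.
Qed.

End CircleCurve.

Section Spheres.
Context {R : realType} {n : nat}.
Implicit Types p v w : 'rV[R]_(n + 1).

Definition pole : 'rV[R]_(n + 1) := row_mx 0 1%:M.

Lemma dot_row_mx (x y : 'rV[R]_n) (s t : R) :
  dot (row_mx x s%:M) (row_mx y t%:M) = dot x y + s * t.
Proof.
by rewrite /dot tr_row_mx mul_row_col mxE tr_scalar_mx -scalar_mxM [s * t]lock !mxE -lock.
Qed.

Lemma enorm_eq d (x : 'rV[R]_d) a : 0 <= a -> (enorm x = a) <-> (dot x x = a ^+ 2).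
Proof.
move=> a0; rewrite /enorm; split=> [<-|->]; first by rewrite sqr_sqrtr ?dot_ge0.
by rewrite sqrtr_sqr ger0_norm.
Qed.

Lemma sphereE p : sphere R n p <-> dot p p = 1.
Proof. by rewrite /sphere /= enorm_eq // expr1n. Qed.

Lemma dot_pole : dot pole pole = 1.
Proof. by rewrite dot_row_mx dot0l mulr1 add0r. Qed.

Variables (a b : R).
Hypotheses (a0 : 0 < a) (a1 : a < 1) (bE : b = Num.sqrt (1 - a ^+ 2)).

Lemma b_gt0 : 0 < b.
Proof. by rewrite bE sqrtr_gt0 subr_gt0 expr_lt1 // ltW. Qed.

Lemma ab1 : a ^+ 2 + b ^+ 2 = 1.
Proof.
rewrite bE sqr_sqrtr; first by rewrite addrC subrK.
by rewrite subr_ge0 ltW // expr_lt1 // ltW.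
Qed.

(** The hypersphere is the section of the sphere by the affine hyperplane where
    the last coordinate is [b], so its tangent spaces are cut out by two
    orthogonality conditions. *)
Lemma hypersphereE p :
  hypersphere n a p <-> dot p p = 1 /\ dot p pole = b.
Proof.
rewrite /hypersphere /= -bE; split=> [[x xa <-]|[pp pe]].
  move/(enorm_eq _ (ltW a0)) : xa => xa.
  rewrite !dot_row_mx xa -expr2 ab1; split=> //.
  by rewrite [dot x 0]dotC dot0l mulr1 add0r.
have pb : p = row_mx (lsubmx p) b%:M.
  have <- : rsubmx p 0 0 = b.
    rewrite -pe -{2}[p]hsubmxK {2}[rsubmx p]mx11_scalar dot_row_mx.
    by rewrite [dot _ 0]dotC dot0l mulr1 add0r.
  by rewrite -mx11_scalar hsubmxK.
exists (lsubmx p) => //; apply/enorm_eq; rewrite ?ltW //.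
by move: pp; rewrite pb dot_row_mx row_mxKl -ab1 expr2 => /addIr.
Qed.

Lemma tangent_sphere p v :
  sphere R n p -> tangent (sphere R n) p v <-> dot v p = 0.
Proof.
move=> /sphereE pp; split=> [[c [c0 cS cv]]|vp].
  have := derive_dot_const (r := 1) cv cv; rewrite c0 [dot p v]dotC => H.
  have /eqP : dot v p + dot v p = 0.
    by apply: H; near=> t; apply/sphereE; near: t.
  by rewrite -mulr2n mulrn_eq0 /= => /eqP.
have [|c [c0 dc cc _]] := circle_curve _ vp; first by rewrite pp oner_eq0.
exists c; split=> //.
by near=> t; apply/sphereE; rewrite cc.
Unshelve. all: by end_near. Qed.

Lemma tangent_hypersphere p v : hypersphere n a p ->
  tangent (hypersphere n a) p v <-> dot v p = 0 /\ dot v pole = 0.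
Proof.
move=> /hypersphereE[pp pe]; split=> [[c [c0 cS cv]]|[vp ve]].
  split.
    have := derive_dot_const (r := 1) cv cv; rewrite c0 [dot p v]dotC => H.
    have /eqP : dot v p + dot v p = 0.
      by apply: H; near=> t; have /hypersphereE[] : hypersphere n a (c t) by near: t.
    by rewrite -mulr2n mulrn_eq0 /= => /eqP.
  have := derive_dot_const (r := b) cv (is_derive_cst pole (0 : R) (1 : R)).
  rewrite [dot _ 0]dotC dot0l addr0; apply.
  by near=> t; have /hypersphereE[] : hypersphere n a (c t) by near: t.
(* Turn around the centre b e of the hypersphere, in its hyperplane. *)
pose p' := p - b *: pole.
have p'p' : dot p' p' = a ^+ 2.
  rewrite /p' !dotL [dot pole p]dotC pp pe dot_pole; have := ab1; lra.
have p'e : dot p' pole = 0 by rewrite /p' !dotL pe dot_pole mulr1 subrr.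
have vp' : dot v p' = 0 by rewrite /p' !dotL vp ve mulr0 subrr.
have [|c [c0 dc cc cw]] := circle_curve _ vp'.
  by rewrite p'p' expf_neq0 // gt_eqF.
exists (fun t => b *: pole + c t); split.
- by rewrite c0 /p' addrC subrK.
- near=> t; apply/hypersphereE.
  have ce : dot (c t) pole = 0 by exact: cw.
  rewrite !dotL dot_pole [dot pole (c t)]dotC ce cc p'p'.
  by split; [rewrite -[RHS]ab1|]; ring.
- have := is_deriveD (is_derive_cst (b *: pole) (0 : R) (1 : R)) dc.
  by rewrite add0r.
Unshelve. all: by end_near. Qed.

Lemma oproj_tangent_sphere p v : sphere R n p ->
  oproj (tangent (sphere R n) p) v = v - dot v p *: p.
Proof.
move=> Sp; have pp := (sphereE p).1 Sp; apply: oprojE.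
- move=> x y /(tangent_sphere _ Sp) xp /(tangent_sphere _ Sp) yp.
  by apply/(tangent_sphere _ Sp); rewrite !dotL xp yp subrr.
- by apply/(tangent_sphere _ Sp); rewrite !dotL pp mulr1 subrr.
- move=> z /(tangent_sphere _ Sp) zp.
  by rewrite opprB addrC subrK dotL [dot p z]dotC zp mulr0.
Qed.

(** The unit normal of the hypersphere in the sphere at [p].  It is locked so that
    unification never sees the difference behind it. *)
Definition eta p := locked ((b / a) *: p - a^-1 *: pole).

Lemma etaE p : eta p = (b / a) *: p - a^-1 *: pole.
Proof. by rewrite /eta -lock. Qed.

Lemma dot_eta_p p : hypersphere n a p -> dot p (eta p) = 0.
Proof.
move=> /hypersphereE[pp pe]; rewrite etaE !dotL pp pe; field.
by rewrite gt_eqF.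
Qed.

Lemma dot_eta p : hypersphere n a p -> dot (eta p) (eta p) = 1.
Proof.
move=> /hypersphereE[pp pe].
have an0 : a != 0 by rewrite gt_eqF.
rewrite etaE !dotL [dot pole p]dotC pp pe dot_pole.
apply: (mulfI (expf_neq0 2 an0)).
apply: (@etrans _ _ (1 - b ^+ 2)); first by field.
by rewrite mulr1 -ab1 addrK.
Qed.

Lemma oproj_tangent_hypersphere p v : hypersphere n a p ->
  oproj (tangent (hypersphere n a) p) v =
  v - dot v p *: p - dot v (eta p) *: eta p.
Proof.
move=> Sp; have [pp pe] := (hypersphereE p).1 Sp.
have hT x : tangent (hypersphere n a) p x <-> dot x p = 0 /\ dot x (eta p) = 0.
  split=> [/(tangent_hypersphere _ Sp)[xp xe]|[xp xe]].
    by rewrite etaE !dotL xp xe !mulr0 subrr.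
  apply/(tangent_hypersphere _ Sp); split => //.
  move: xe; rewrite etaE !dotL xp mulr0 add0r => /eqP.
  by rewrite oppr_eq0 mulf_eq0 invr_eq0 gt_eqF //= => /eqP.
have pe0 := dot_eta_p Sp; have ee := dot_eta Sp; apply: oprojE.
- move=> x y /hT [xp xe] /hT [yp ye].
  by apply/hT; rewrite !dotL xp xe yp ye subrr.
- apply/hT; rewrite !dotL pp [dot (eta p) p]dotC pe0 ee.
  by split; ring.
- move=> z /hT [zp ze].
  by rewrite !dotL [dot p z]dotC [dot (eta p) z]dotC zp ze; ring.
Qed.

End Spheres.

(** * The induced connection of a patch *)

Section InducedConnection.
Context {R : realType} {m d : nat}.
Variable P : Defs.patch R m d.
Hypotheses (Uo : open (dom P)) (Ps : smooth_on (dom P) P).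
Hypothesis Pi : forall u, dom P u -> injective ('d P u).
Implicit Types (u : 'rV[R]_m) (v w : 'rV[R]_d).

Lemma partial_near (f g : 'rV[R]_m -> 'rV[R]_d) u i :
  (forall x, dom P x -> f x = g x) -> dom P u -> partial i f u = partial i g u.
Proof.
move=> fg Uu; apply: near_eq_derive.
by apply: filterS (near_open Uo Uu) => x /fg.
Qed.

Lemma is_derive_patch u i : dom P u ->
  is_derive u (delta_mx 0 i) P (partial i P u).
Proof. by apply: vck_derive; apply: (smooth_vck Uo 1). Qed.

Lemma is_derive_partial u i j : dom P u ->
  is_derive u (delta_mx 0 i) (partial j P) (partial i (partial j P) u).
Proof. by apply: vck_derive; apply/(vck_partial Uo)/(smooth_vck Uo 2). Qed.

Lemma partialE u i : dom P u -> partial i P u = row i (jacobian P u).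
Proof. by move=> Uu; rewrite rowE /partial deriveEjacobian //; exact: (Ps [::]). Qed.

Lemma diff_jacobian u (x : 'rV[R]_m) : 'd P u x = x *m jacobian P u.
Proof. by rewrite /jacobian mul_rV_lin1. Qed.

Lemma dot_partial u v l : dom P u ->
  dot v (partial l P u) = (v *m (jacobian P u)^T) 0 l.
Proof.
by move=> Uu; rewrite partialE // dotE mxE; apply: eq_bigr => c _; rewrite !mxE.
Qed.

Lemma metricE u : dom P u -> metric P u = jacobian P u *m (jacobian P u)^T.
Proof.
move=> Uu; apply/matrixP => i j; rewrite mxE dot_partial // partialE //.
by rewrite -row_mul mxE.
Qed.

Lemma metricC u i j : metric P u i j = metric P u j i.
Proof. by rewrite mxE [RHS]mxE; exact: dotC. Qed.

(** The metric is the Gram matrix J J^T of the jacobian, and x J J^T x^T is the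
    squared length of the image of x by the injective differential. *)
Lemma metric_unit u : dom P u -> metric P u \in unitmx.
Proof.
move=> Uu; rewrite -row_free_unit; apply/inj_row_free => x xG.
apply: (Pi Uu); rewrite linear0 diff_jacobian; apply: dot_eq0.
by rewrite /dot trmx_mul mulmxA -[x *m _ *m _]mulmxA -metricE // xG mul0mx mxE.
Qed.

Lemma metric_invC u i j : metric_inv P u i j = metric_inv P u j i.
Proof.
have GT : (metric P u)^T = metric P u by apply/matrixP => k l; rewrite mxE metricC.
by rewrite /metric_inv -{1}GT -trmx_inv mxE.
Qed.

Lemma trace_metric u : dom P u ->
  \sum_i \sum_j metric_inv P u i j * metric P u i j = m%:R.
Proof.
move=> Uu; rewrite -[RHS](mxtrace1 R) -(mulVmx (metric_unit Uu)).
apply: eq_bigr => i _; rewrite mxE; apply: eq_bigr => j _.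
by rewrite [metric P u i j]metricC.
Qed.

(** The orthogonal projection on the tangent space of the patch, in the
    coordinate frame: [oproj_range] below. *)
Definition tanpart u v : 'rV[R]_d :=
  \sum_k (\sum_l dot v (partial l P u) * metric_inv P u l k) *: partial k P u.

Lemma tanpartE u v : dom P u ->
  tanpart u v =
  v *m (jacobian P u)^T *m metric_inv P u *m jacobian P u.
Proof.
move=> Uu; rewrite [RHS]mulmx_sum_row; apply: eq_bigr => k _.
rewrite partialE // mxE; congr (_ *: _); apply: eq_bigr => l _.
by rewrite -dot_partial.
Qed.

Lemma tanpartD u v w : tanpart u (v + w) = tanpart u v + tanpart u w.
Proof.
rewrite -big_split /=; apply: eq_bigr => k _; rewrite -scalerDl -big_split /=.
by congr (_ *: _); apply: eq_bigr => l _; rewrite dotDl mulrDl.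
Qed.

Lemma tanpart_normal u v : (forall l, dot v (partial l P u) = 0) ->
  tanpart u v = 0.
Proof.
move=> vX; apply: big1 => k _; rewrite big1 ?scale0r // => l _.
by rewrite vX mul0r.
Qed.

Lemma dot_tanpart u v w : (forall l, dot (partial l P u) w = 0) ->
  dot (tanpart u v) w = 0.
Proof. by move=> wX; rewrite dot_suml big1 // => k _; rewrite dotZl wX mulr0. Qed.

Lemma dot_sub_tanpart u v l : dom P u ->
  dot (v - tanpart u v) (partial l P u) = 0.
Proof.
move=> Uu; rewrite dot_partial // tanpartE // mulmxBl -!mulmxA -metricE //.
by rewrite mulVmx ?metric_unit // mulmx1 subrr mxE.
Qed.

Lemma oproj_range u v : dom P u -> oproj (range ('d P u)) v = tanpart u v.
Proof.
move=> Uu; have rE x : range ('d P u) x <-> exists y, y *m jacobian P u = x.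
  by split=> [[y _ <-]|[y <-]]; exists y; rewrite // diff_jacobian.
apply: oprojE.
- move=> x y /rE[x' <-] /rE[y' <-]; apply/rE; exists (x' - y').
  by rewrite mulmxBl.
- by apply/rE; rewrite tanpartE //; eexists.
- move=> z /rE[x <-]; rewrite mulmx_sum_row dotC dot_suml big1 // => k _.
  by rewrite dotZl -partialE // dotC dot_sub_tanpart // mulr0.
Qed.

Lemma dmetricE l i j u : dom P u ->
  dmetric P l i j u = dot (partial l (partial i P) u) (partial j P u) +
                      dot (partial i P u) (partial l (partial j P) u).
Proof.
move=> Uu; rewrite /dmetric.
have -> : (fun x => metric P x i j) = (fun x => dot (partial i P x) (partial j P x)).
  by apply/funext => x; rewrite mxE.
by have [_ ->] := is_derive_dot (is_derive_partial l i Uu) (is_derive_partial l j Uu).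
Qed.

(** Koszul: the derivatives of the metric are scalar products of first and
    second partial derivatives of [P], and all but one cancel by symmetry of the
    latter. *)
Lemma christoffelE k i j u : dom P u ->
  christoffel P k i j u =
  \sum_l dot (partial i (partial j P) u) (partial l P u) * metric_inv P u l k.
Proof.
(* Stated for arbitrary families: matching against actual partial derivatives
   would unfold them. *)
have koszul (D : 'I_m -> 'I_m -> 'rV[R]_d) (X : 'I_m -> 'rV[R]_d) g l :
    (forall i j, D i j = D j i) ->
    2^-1 * (g * (dot (D i j) (X l) + dot (X j) (D i l) +
      (dot (D j i) (X l) + dot (X i) (D j l)) -
      (dot (D l i) (X j) + dot (X i) (D l j)))) = dot (D i j) (X l) * g.
  move=> DC; rewrite (DC j i) (DC l i) (DC l j) [dot (X j) _]dotC.
  by field.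
move=> Uu; rewrite /christoffel mulr_sumr; apply: eq_bigr => l _.
rewrite !dmetricE // [metric_inv P u k l]metric_invC.
apply: (koszul (fun i j => partial i (partial j P) u) (fun i => partial i P u)).
by move=> i' j'; apply: (smooth_partialC Uo).
Qed.

Lemma sum_christoffel i j u : dom P u ->
  \sum_k christoffel P k i j u *: partial k P u =
  tanpart u (partial i (partial j P) u).
Proof. by move=> Uu; apply: eq_bigr => k _; rewrite christoffelE. Qed.

Lemma ck_metric_inv k i j : ck (dom P) k (fun u => metric_inv P u i j).
Proof.
apply: (ck_invmx Uo) => [u|l c]; first exact: metric_unit.
apply: (ck_eq Uo _ (vck_dot Uo (vck_partial Uo l (smooth_vck Uo k.+1 Ps))
  (vck_partial Uo c (smooth_vck Uo k.+1 Ps)))) => u _.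
by rewrite mxE.
Qed.

End InducedConnection.

(** * Patches in the hypersphere *)

Section PatchInHypersphere.
Context {R : realType} {m n : nat}.
Variables (a b : R) (P : Defs.patch R m (n + 1)).
Hypotheses (a0 : 0 < a) (a1 : a < 1) (bE : b = Num.sqrt (1 - a ^+ 2)).
Hypothesis m0 : (0 < m)%N.
Hypotheses (Uo : open (dom P)) (Ps : smooth_on (dom P) P).
Hypothesis Pi : forall u, dom P u -> injective ('d P u).
Hypothesis PN : forall u, dom P u -> hypersphere n a (P u).
Implicit Types (u : 'rV[R]_m) (v w : 'rV[R]_(n + 1)).

Local Notation X i u := (partial i P u).
Local Notation XX i j u := (partial i (partial j P) u).
Local Notation g := (metric P).
Local Notation ginv := (metric_inv P).
Local Notation normal u := (eta a b (P u)).
Local Notation S := (sphere R n).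
Local Notation H := (mean_curvature (sphere R n) P).

Let mn0 : m%:R != 0 :> R.
Proof. by rewrite pnatr_eq0 -lt0n. Qed.

Lemma patch_unit u : dom P u -> dot (P u) (P u) = 1.
Proof. by move=> /PN /(hypersphereE a0 a1 bE)[]. Qed.

Lemma patch_sphere u : dom P u -> S (P u).
Proof. by move=> /patch_unit /sphereE. Qed.

Lemma dot_partial_patch u i : dom P u -> dot (X i u) (P u) = 0.
Proof.
move=> Uu; have XP := is_derive_patch Uo Ps i Uu.
have := derive_dot_const (r := 1) XP XP; rewrite [dot (P u) _]dotC => h.
have /eqP : dot (X i u) (P u) + dot (X i u) (P u) = 0.
  by apply: h; apply: filterS (near_open Uo Uu) => x /patch_unit.
by rewrite -mulr2n mulrn_eq0 /= => /eqP.
Qed.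

Lemma dot_partial_pole u i : dom P u -> dot (X i u) (pole (n := n)) = 0.
Proof.
move=> Uu; have XP := is_derive_patch Uo Ps i Uu.
have := derive_dot_const (r := b) XP
  (is_derive_cst (pole (n := n)) u (delta_mx 0 i)).
rewrite [dot (P u) 0]dotC dot0l addr0; apply.
by apply: filterS (near_open Uo Uu) => x /PN /(hypersphereE a0 a1 bE)[].
Qed.

Lemma dot_partial_normal u i : dom P u -> dot (X i u) (normal u) = 0.
Proof.
move=> Uu; rewrite etaE dotBr !dotZr dot_partial_patch // dot_partial_pole //.
by rewrite !mulr0 subrr.
Qed.

Lemma is_derive_normal u i : dom P u ->
  is_derive u (delta_mx 0 i) (fun x => normal x) ((b / a) *: X i u).
Proof.
move=> Uu; have XP := is_derive_patch Uo Ps i Uu.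
under eq_fun do rewrite etaE.
have := is_deriveB (is_deriveZ (b / a) XP)
  (is_derive_cst (a^-1 *: pole (n := n)) u (delta_mx 0 i)).
by rewrite subr0.
Qed.

Lemma dot_partial2_patch u i j : dom P u -> dot (XX i j u) (P u) = - g u i j.
Proof.
move=> Uu; apply/eqP; rewrite -addr_eq0 mxE [dot (X i u) _]dotC; apply/eqP.
apply: (derive_dot_const (r := 0) (is_derive_partial Uo Ps i j Uu)
  (is_derive_patch Uo Ps i Uu)).
by apply: filterS (near_open Uo Uu) => x /dot_partial_patch.
Qed.

Lemma dot_partial2_normal u i j : dom P u ->
  dot (XX i j u) (normal u) = - (b / a * g u i j).
Proof.
move=> Uu; apply/eqP; rewrite -addr_eq0 mxE [dot (X i u) _]dotC -dotZr; apply/eqP.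
apply: (derive_dot_const (r := 0) (is_derive_partial Uo Ps i j Uu)
  (is_derive_normal i Uu)).
by apply: filterS (near_open Uo Uu) => x /dot_partial_normal.
Qed.

(** The second fundamental form of the patch in the flat ambient space. *)
Definition bending i j u := XX i j u - tanpart P u (XX i j u).

(** Going from the flat space to [N] adds to the derivative of the coordinate
    fields a vector [w] normal to the patch, and so changes the second
    fundamental form by [w]. *)
Lemma sff_normal N u i j w : dom P u ->
  (forall l, dot w (X l u) = 0) -> covder N P i (partial j P) u = XX i j u + w ->
  second_fundamental_form N P i j u = bending i j u + w.
Proof.
move=> Uu wX E; rewrite /second_fundamental_form E oproj_range //.
by rewrite tanpartD (tanpart_normal wX) addr0 addrAC.
Qed.

Lemma covderE i (f : 'rV[R]_m -> 'rV[R]_(n + 1)) u : dom P u ->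
  covder S P i f u = partial i f u - dot (partial i f u) (P u) *: P u.
Proof. by move=> Uu; rewrite /covder oproj_tangent_sphere //; exact: patch_sphere. Qed.

Lemma sff_sphere u i j : dom P u ->
  second_fundamental_form S P i j u = bending i j u + g u i j *: P u.
Proof.
move=> Uu; apply: sff_normal => // [l|].
  by rewrite dotZl dotC dot_partial_patch // mulr0.
by rewrite covderE // dot_partial2_patch // scaleNr opprK.
Qed.

Lemma sff_hypersphere u i j : dom P u ->
  second_fundamental_form (hypersphere n a) P i j u =
  bending i j u + g u i j *: (P u + (b / a) *: normal u).
Proof.
move=> Uu; apply: sff_normal => // [l|].
  rewrite dotZl dotDl dotZl dotC dot_partial_patch //.
  by rewrite [dot _ (X l u)]dotC dot_partial_normal // mulr0 addr0 mulr0.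
rewrite /covder (oproj_tangent_hypersphere a0 a1 bE); last exact: PN.
rewrite dot_partial2_patch // dot_partial2_normal //.
by rewrite !scaleNr !opprK -addrA scalerDr scalerA [g u i j * _]mulrC.
Qed.

(** The trace of the metric is [m], so a term g_ij w in the second fundamental
    form adds [w] to the mean curvature. *)
Lemma mean_shift N u w : dom P u ->
  (forall i j, second_fundamental_form N P i j u = bending i j u + g u i j *: w) ->
  mean_curvature N P u =
  m%:R^-1 *: (\sum_i \sum_j ginv u i j *: bending i j u) + w.
Proof.
move=> Uu E; rewrite /mean_curvature.
have -> : \sum_i \sum_j ginv u i j *: second_fundamental_form N P i j u =
    \sum_i \sum_j ginv u i j *: bending i j u + m%:R *: w.
  rewrite -(trace_metric Ps Pi Uu) scaler_suml -big_split /=.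
  apply: eq_bigr => i _; rewrite scaler_suml -big_split /=.
  by apply: eq_bigr => j _; rewrite E scalerDr scalerA.
by rewrite scalerDr scalerA mulVf // scale1r.
Qed.

Lemma mean_sphere u : dom P u ->
  H u = m%:R^-1 *: (\sum_i \sum_j ginv u i j *: bending i j u) + P u.
Proof. by move=> Uu; apply: mean_shift => // i j; exact: sff_sphere. Qed.

Lemma mean_hypersphere u : dom P u ->
  mean_curvature (hypersphere n a) P u = H u + (b / a) *: normal u.
Proof.
move=> Uu; rewrite mean_sphere // -addrA; apply: mean_shift => // i j.
exact: sff_hypersphere.
Qed.

(** Used with three normal fields [w]: the position, eta, and [H] itself. *)
Lemma dot_mean u w : dom P u -> (forall l, dot (X l u) w = 0) ->
  m%:R * dot (H u) w =
  \sum_i \sum_j ginv u i j * dot (XX i j u) w + m%:R * dot (P u) w.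
Proof.
move=> Uu wX; rewrite mean_sphere // dotDl dotZl mulrDr mulrA divff // mul1r.
congr (_ + _); rewrite dot_suml; apply: eq_bigr => i _; rewrite dot_suml.
by apply: eq_bigr => j _; rewrite dotZl dotBl dot_tanpart // subr0.
Qed.

Lemma trace_metricZ u r : dom P u ->
  \sum_i \sum_j ginv u i j * - (r * g u i j) = - (m%:R * r).
Proof.
move=> Uu; rewrite -(trace_metric Ps Pi Uu) mulr_suml -sumrN.
apply: eq_bigr => i _; rewrite mulr_suml -sumrN.
by apply: eq_bigr => j _; ring.
Qed.

Lemma dot_mean_patch u : dom P u -> dot (H u) (P u) = 0.
Proof.
move=> Uu; apply: (mulfI mn0); rewrite dot_mean //; last first.
  by move=> l; exact: dot_partial_patch.
rewrite patch_unit // mulr0 -[Z in _ + Z]opprK -(trace_metricZ 1 Uu).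
apply/eqP; rewrite subr_eq0; apply/eqP.
apply: eq_bigr => i _; apply: eq_bigr => j _.
by rewrite dot_partial2_patch // mul1r.
Qed.

Lemma dot_mean_normal u : dom P u -> dot (H u) (normal u) = - (b / a).
Proof.
move=> Uu; apply: (mulfI mn0); rewrite dot_mean //; last first.
  by move=> l; exact: dot_partial_normal.
rewrite (dot_eta_p a0 a1 bE); last exact: PN.
rewrite mulr0 addr0 mulrN -(trace_metricZ _ Uu).
by apply: eq_bigr => i _; apply: eq_bigr => j _; rewrite dot_partial2_normal.
Qed.

Lemma dot_mean_partial u l : dom P u -> dot (H u) (X l u) = 0.
Proof.
move=> Uu; rewrite mean_sphere // dotDl dotZl dot_suml big1; last first.
  move=> i _; rewrite dot_suml big1 // => j _.
  by rewrite dotZl (dot_sub_tanpart Ps Pi) // mulr0.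
by rewrite mulr0 add0r dotC dot_partial_patch.
Qed.

Lemma mean_norm u : dom P u ->
  \sum_i \sum_j ginv u i j * dot (XX i j u) (H u) = m%:R * dot (H u) (H u).
Proof.
move=> Uu; rewrite (dot_mean (w := H u)) //.
  by rewrite [dot (P u) _]dotC dot_mean_patch // mulr0 addr0.
by move=> l; rewrite dotC dot_mean_partial.
Qed.

(** Here nabla_j H = r X_j with r = -(b^2 / a^2), so the second covariant
    derivative is r times the second fundamental form in the sphere, the
    Christoffel terms removing the tangential part. *)
Lemma minimal_biharmonic u : dom P u ->
  (forall x, dom P x -> H x = - (b / a) *: normal x) ->
  rough_laplacian S P H u = (b ^+ 2 / a ^+ 2 * m%:R) *: H u.
Proof.
move=> Uu HE.
(* A local definition of r would be unfolded by the rules on opposites. *)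
have [r rE] : exists r, r = - (b ^+ 2 / a ^+ 2) by eexists.
have dH j x : dom P x -> covder S P j H x = r *: X j x.
  move=> Ux; have -> : covder S P j H x = covder S P j (fun y => - (b / a) *: normal y) x.
    by rewrite /covder (partial_near Uo j HE Ux).
  have [_ E] := is_deriveZ (- (b / a)) (is_derive_normal j Ux).
  rewrite covderE // /partial [Z in Z - _]E [Z in dot Z]E.
  rewrite !dotZl dot_partial_patch // !mulr0 scale0r subr0 scalerA.
  by congr (_ *: _); rewrite rE; field; rewrite gt_eqF.
have ddH i j : second_covder S P i j H u = r *: second_fundamental_form S P i j u.
  rewrite /second_covder /covder (partial_near Uo i (dH j) Uu) -/(covder S P i _ u).
  have [_ E] := is_deriveZ r (is_derive_partial Uo Ps i j Uu).
  rewrite covderE // /partial [Z in Z - _ - _]E [Z in dot Z]E.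
  rewrite dotZl dot_partial2_patch // sff_sphere //.
  under eq_bigr do rewrite -/(covder S P _ _ u) dH // scalerA mulrC -scalerA.
  rewrite -scaler_sumr (sum_christoffel Uo Ps) //.
  by rewrite mulrN scaleNr opprK -scalerA addrAC -scalerBr -scalerDr.
rewrite /rough_laplacian /mean_curvature scalerA mulfK //.
rewrite -scaleN1r !scaler_sumr; apply: eq_bigr => i _.
rewrite !scaler_sumr; apply: eq_bigr => j _.
by rewrite ddH !scalerA; congr (_ *: _); rewrite rE; ring.
Qed.

(** On the patch, [H] is a rational expression in the partial derivatives of [P]
    whose only denominator is the determinant of the metric. *)
Lemma mean_vck k : vck (dom P) k H.
Proof.
have PS l : vck (dom P) l P := smooth_vck Uo l Ps.
have XS i l : vck (dom P) l (partial i P) by exact/(vck_partial Uo)/PS.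
have XXS i j : vck (dom P) k (partial i (partial j P)).
  exact/(vck_partial Uo)/XS.
move=> c; pose Y i j u := XX i j u 0 c - \sum_q
  (\sum_l dot (XX i j u) (X l u) * ginv u l q) * X q u 0 c.
apply: (ck_eq Uo (f := fun u => m%:R^-1 * (\sum_i \sum_j ginv u i j * Y i j u)
  + P u 0 c)).
  move=> u Uu; rewrite mean_sphere // mxE; congr (_ + _); rewrite mxE.
  congr (_ * _); rewrite summxE; apply: eq_bigr => i _.
  rewrite summxE; apply: eq_bigr => j _; rewrite mxE; congr (_ * _).
  rewrite mxE; congr (_ + _); rewrite mxE summxE; congr (- _).
  by apply: eq_bigr => q _; rewrite [RHS]mxE.
apply: (ckD Uo) (PS k c); apply: (ckM Uo); first exact: (ck_cst Uo k _).
apply: (ck_sum Uo) => i; apply: (ck_sum Uo) => j; apply: (ckM Uo).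
  exact: ck_metric_inv.
apply: (ckD Uo); first exact: XXS.
apply: (ckN Uo); apply: (ck_sum Uo) => q; apply: (ckM Uo); last exact: XS.
apply: (ck_sum Uo) => l; apply: (ckM Uo); last exact: ck_metric_inv.
by apply: (vck_dot Uo); [exact: XXS|exact: XS].
Qed.

(** <H, eta> is constant and d_j eta is tangent to the patch, hence orthogonal
    to [H]; the projection on the sphere does not affect the component along
    eta. *)
Lemma covder_mean_normal j u : dom P u ->
  dot (covder S P j H u) (normal u) = 0.
Proof.
move=> Uu; rewrite covderE // dotBl dotZl (dot_eta_p a0 a1 bE); last exact: PN.
rewrite mulr0 subr0; apply: etrans (derive_dot_constl (r := - (b / a))
  (vck_derive j (mean_vck 1) Uu) (is_derive_normal j Uu) _) _.
  by apply: filterS (near_open Uo Uu) => x; exact: dot_mean_normal.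
by rewrite dotZr dot_mean_partial // mulr0 oppr0.
Qed.

(** [H] is normal to the patch: differentiate <H, X_i> = 0. *)
Lemma covder_mean_partial i j u : dom P u ->
  dot (covder S P j H u) (X i u) = - dot (XX j i u) (H u).
Proof.
move=> Uu; rewrite covderE // dotBl dotZl [dot (P u) _]dotC dot_partial_patch //.
rewrite mulr0 subr0; apply: etrans (derive_dot_constl (r := 0)
  (vck_derive j (mean_vck 1) Uu) (is_derive_partial Uo Ps j i Uu) _) _.
  by apply: filterS (near_open Uo Uu) => x; exact: dot_mean_partial.
by congr (- _); exact: dotC.
Qed.

Lemma covder_mean_vck k j : vck (dom P) k (covder S P j H).
Proof.
have dHS : vck (dom P) k (partial j H) by exact/(vck_partial Uo)/mean_vck.
have PS : vck (dom P) k P by exact: (smooth_vck Uo).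
move=> c; apply: (ck_eq Uo (f := fun x => partial j H x 0 c +
    - (dot (partial j H x) (P x) * P x 0 c))).
  by move=> x Ux; rewrite covderE // mxE; congr (_ + _);
    rewrite mxE; congr (- _); rewrite mxE.
apply: (ckD Uo); first exact: dHS.
apply/(ckN Uo)/(ckM Uo); last exact: PS.
exact: (vck_dot Uo).
Qed.

(** Differentiate <nabla_j H, eta> = 0, with d_i eta = (b / a) X_i. *)
Lemma covder2_mean_normal i j u : dom P u ->
  dot (covder S P i (covder S P j H) u) (normal u) =
  b / a * dot (XX j i u) (H u).
Proof.
move=> Uu; rewrite covderE // dotBl dotZl (dot_eta_p a0 a1 bE); last exact: PN.
rewrite mulr0 subr0; apply: etrans (derive_dot_constl (r := 0)
  (vck_derive i (covder_mean_vck 1 j) Uu) (is_derive_normal i Uu) _) _.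
  by apply: filterS (near_open Uo Uu) => x; exact: covder_mean_normal.
by rewrite dotZr covder_mean_partial // mulrN opprK.
Qed.

(** The Christoffel terms have no component along eta, and the trace of the
    previous formula is computed by [mean_norm]. *)
Lemma dot_laplacian_normal u : dom P u ->
  dot (rough_laplacian S P H u) (normal u) =
  - (b / a * (m%:R * dot (H u) (H u))).
Proof.
move=> Uu; rewrite -mean_norm // [in RHS]exchange_big dotNl dot_suml.
rewrite mulr_sumr; congr (- _); apply: eq_bigr => i _.
rewrite dot_suml mulr_sumr; apply: eq_bigr => j _.
rewrite metric_invC mulrCA dotZl; congr (_ * _).
rewrite dotBl covder2_mean_normal // dot_suml big1 ?subr0 // => k _.
by rewrite dotZl covder_mean_normal // mulr0.
Qed.

(** The component along eta of the equation gives |H|^2 = b^2 / a^2; as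
    <H, eta> = -(b / a) and |eta| = 1, the vector H + (b / a) eta has length
    0. *)
Lemma biharmonic_minimal u : dom P u ->
  rough_laplacian S P H u = (b ^+ 2 / a ^+ 2 * m%:R) *: H u ->
  H u = - (b / a) *: normal u.
Proof.
move=> Uu E; have b0 := b_gt0 a0 a1 bE.
have := dot_laplacian_normal Uu; rewrite E dotZl dot_mean_normal // => /eqP.
have -> : b ^+ 2 / a ^+ 2 * m%:R * - (b / a) =
    - (b / a * (m%:R * (b ^+ 2 / a ^+ 2))) by ring.
rewrite eqr_opp => /eqP E1.
have /(mulfI mn0) HH : m%:R * (b ^+ 2 / a ^+ 2) = m%:R * dot (H u) (H u).
  by apply: (mulfI _ E1); rewrite gt_eqF // divr_gt0.
have HN := dot_mean_normal Uu; have NN := dot_eta a0 a1 bE (PN Uu).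
(* Abstracted, so that bilinearity does not expand the mean curvature. *)
move: (H u) (normal u) HH HN NN {E E1} => h e hh he ee.
apply/eqP; rewrite scaleNr -addr_eq0; apply/eqP/dot_eq0.
rewrite !dotL [dot e h]dotC he ee -hh; field.
by rewrite gt_eqF.
Qed.

End PatchInHypersphere.

(** * Harmonicity and biharmonicity *)

Theorem mainTheorem2 (R : realType) (n m : nat) (a b : R)
    (M : submanifold R m (n + 1)) :
  0 < a -> a < 1 -> b = Num.sqrt (1 - a ^+ 2) ->
  (0 < m)%N -> M !=set0 -> M `<=` hypersphere n a ->
  harmonic_in (hypersphere n a) M <->
  properly_biharmonic_in_sphere (m%:R * (1 - b ^+ 2 / a ^+ 2)) M.
Proof.
move=> a0 a1 bE m0 M0 MN.
have PN P : patches M P -> forall u, dom P u -> hypersphere n a (P u).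
  by move=> MP u Uu; apply/MN/(patch_sub MP); exists u.
have minimalE P u : patches M P -> dom P u ->
    mean_curvature (hypersphere n a) P u = 0 <->
    mean_curvature (sphere R n) P u = - (b / a) *: eta a b (P u).
  move=> MP Uu; rewrite (mean_hypersphere a0 a1 bE m0 (patch_open MP)
    (patch_smooth MP) (patch_immersion MP) (PN P MP) Uu) scaleNr.
  by split=> [/eqP|->]; [rewrite addr_eq0 => /eqP|rewrite addNr].
(* The biharmonic equation of index m (1 - b^2 / a^2) is an eigenvalue
   equation. *)
have biharmonicE (L h : 'rV[R]_(n + 1)) :
    L - m%:R *: h + (m%:R * (1 - b ^+ 2 / a ^+ 2)) *: h = 0 <->
    L = (b ^+ 2 / a ^+ 2 * m%:R) *: h.
  rewrite -addrA -scaleNr -scalerDl.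
  have -> : - m%:R + m%:R * (1 - b ^+ 2 / a ^+ 2) =
    - (b ^+ 2 / a ^+ 2 * m%:R) by ring.
  by rewrite scaleNr; split=> [/subr0_eq|->]; rewrite ?subrr.
split=> [Mh|[Mb _] P MP u Uu].
  split=> [P MP u Uu|Sh].
    apply: (biharmonicE _ _).2; apply: (minimal_biharmonic a0 a1 bE m0 (patch_open MP)
      (patch_smooth MP) (patch_immersion MP) (PN P MP)) => // x Ux.
    exact: (minimalE P x MP Ux).1 (Mh P MP x Ux).
  have [p /patch_cover[P MP [u Uu _]]] := M0.
  have := dot_mean_normal a0 a1 bE m0 (patch_open MP)
      (patch_smooth MP) (patch_immersion MP) (PN P MP) Uu.
  rewrite (Sh P MP u Uu) dot0l => /eqP.
  by rewrite eq_sym oppr_eq0 gt_eqF // divr_gt0 // (b_gt0 a0 a1 bE).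
apply: (minimalE P u MP Uu).2.
apply: (biharmonic_minimal a0 a1 bE m0 (patch_open MP)
      (patch_smooth MP) (patch_immersion MP) (PN P MP)) => //.
exact: (biharmonicE _ _).1 (Mb P MP u Uu).
Qed.
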